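(* Let $d\ge1$ be an integer, $H\in(0,1)$, let $f:[0,1]\to\mathbb{R}^d$ be a Borel measurable function and let $A$ be a Borel subset of $[0,1]$. Then $$\dim(A)\le\dim_{\Psi,H}(Gr_A(f)).$$ If in addition $f$ is $\alpha$-Hölder continuous for some exponent $0<\alpha\le H$, then $$\dim_{\Psi,H}(Gr_A(f))\le\min\left\{\frac{H}{\alpha}\dim(A),\ \dim(A)+(H-\alpha)d\right\}.$$ In particular, if $f$ is $(H-\varepsilon)$-Hölder continuous for all (sufficiently small) $\varepsilon>0$, then $$\dim(A)=\dim_{\Psi,H}(Gr_A(f)).$$
   Context: $\dim$ denotes the usual Hausdorff dimension of subsets of $\mathbb{R}$, and $Gr_A(f)=\{(t,f(t)):t\in A\}\subset\mathbb{R}_+\times\mathbb{R}^d$ is the graph of $f$ over $A$. A function $f:[0,1]\to\mathbb{R}^d$ is $\alpha$-Hölder continuous if there is $K\ge0$ such that $\|f(x)-f(y)\|_\infty\le K|x-y|^\alpha$ for all $x,y\in[0,1]$, where $\|\cdot\|_\infty$ is the maximum norm. For $H\in(0,1)$, $\beta>0$ and $F\subset\mathbb{R}_+\times\mathbb{R}^d$, the $H$-parabolic $\beta$-dimensional Hausdorff content is $$\Psi_H^\beta(F)=\inf\Big\{\sum_j\delta_j^\beta:\ F\subseteq\bigcup_j [a_j,a_j+\delta_j]\times[b_{j,1},b_{j,1}+\delta_j^H]\times\cdots\times[b_{j,d},b_{j,d}+\delta_j^H]\Big\},$$ the infimum being over all countable covers of $F$ by sets of this form. The $H$-parabolic Hausdorff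 dimension is $\dim_{\Psi,H}(F)=\inf\{\beta>0:\Psi_H^\beta(F)=0\}$. *)

(* Defs.v *)
From HB Require Import structures.
From mathcomp Require Import all_boot all_order all_algebra.
From mathcomp Require Import all_classical all_reals all_analysis.

Set Implicit Arguments.
Unset Strict Implicit.
Unset Printing Implicit Defensive.
Import Order.TTheory GRing.Theory Num.Theory.
Import numFieldNormedType.Exports.
Local Open Scope classical_set_scope.
Local Open Scope ring_scope.
Local Open Scope ereal_scope.

(* Equal to -oo on the empty set, which diam_pow treats separately. *)
Definition diam (R : realType) (U : set R) : \bar R :=
  ereal_sup [set (`|x - y|%R)%:E | x in U & y in U].

(* Convention: the empty set contributes 0 for every s, including s = 0, while
   a singleton contributes 0 `^ 0 = 1 for s = 0. *)
Definition diam_pow (R : realType) (s : R) (U : set R) : \bar R :=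
  if U == set0 then 0 else diam U `^ s.

Definition hausdorff_premeasure (R : realType) (s e : R) (A : set R) : \bar R :=
  ereal_inf [set \sum_(k <oo) diam_pow s (U k) |
    U in [set U : (set R)^nat | A `<=` \bigcup_k U k /\
                                forall k, diam (U k) <= e%:E]].

Definition hausdorff_measure (R : realType) (s : R) (A : set R) : \bar R :=
  ereal_sup [set hausdorff_premeasure s e A | e in [set e : R | (0 < e)%R]].

Definition hausdorff_dim (R : realType) (A : set R) : \bar R :=
  ereal_inf [set s%:E | s in [set s : R | (0 <= s)%R /\
                                          hausdorff_measure s A = 0]].

Definition parabolic_box (R : realType) (d : nat) (H a r : R) (b : 'rV[R]_d)
    : set (R * 'rV[R]_d) :=
  [set p : R * 'rV[R]_d | (a <= p.1 <= a + r)%R /\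
           forall i : 'I_d, (b ord0 i <= p.2 ord0 i <= b ord0 i + r `^ H)%R].

(* Covers are indexed by nat; since r k = 0 is allowed and 0 `^ beta = 0 for
   beta > 0, finite covers are included by padding with one-point boxes. *)
Definition parabolic_content (R : realType) (d : nat) (H beta : R)
    (F : set (R * 'rV[R]_d)) : \bar R :=
  ereal_inf [set x : \bar R | exists (a r : R^nat) (b : ('rV[R]_d)^nat),
    [/\ forall k, (0 <= r k)%R,
        F `<=` \bigcup_k parabolic_box H (a k) (r k) (b k)
      & x = \sum_(k <oo) (r k `^ beta)%:E]].

Definition parabolic_dim (R : realType) (d : nat) (H : R)
    (F : set (R * 'rV[R]_d)) : \bar R :=
  ereal_inf [set beta%:E | beta in [set beta : R | (0 < beta)%R /\
                                      parabolic_content H beta F = 0]].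

Definition graph_on (T U : Type) (A : set T) (f : T -> U) : set (T * U) :=
  [set (t, f t) | t in A].

Definition borel_rV (R : realType) (d : nat) :=
  g_sigma_algebraType (@open 'rV[R]_d).

(* The norm on 'rV[R]_d is the maximum norm. *)
Definition holder01 (R : realType) (d : nat) (alpha : R) (f : R -> 'rV[R]_d)
    : Prop :=
  exists2 K : R, (0 <= K)%R &
    forall x y : R, x \in `[0%R, 1%R] -> y \in `[0%R, 1%R] ->
      (`|f x - f y| <= K * `|x - y| `^ alpha)%R.

(* Main.v *)
Require Import Defs.
From HB Require Import structures.
From mathcomp Require Import all_boot all_order all_algebra.
From mathcomp Require Import all_classical all_reals all_analysis.
From mathcomp Require Import lra ring.

Set Implicit Arguments.
Unset Strict Implicit.
Unset Printing Implicit Defensive.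
Import Order.TTheory GRing.Theory Num.Theory.
Import numFieldNormedType.Exports.
Local Open Scope classical_set_scope.
Local Open Scope ring_scope.
Local Open Scope ereal_scope.

(** The lower bound is a projection: a parabolic cover of the graph, projected
  on the time axis, gives a cover of A by intervals of lengths r_k, so
  vanishing parabolic content in dimension beta forces vanishing Hausdorff
  measure in dimension beta. The diameters of this cover are small because
  each r_k ^ beta is at most the small sum
  ([hausdorff_measure_graph_eq0]).

  For the upper bounds, cover A by sets U of diameter delta <= 1. If f is
  alpha-Hölder with constant K, the graph over A `&` U lies in a slab of
  duration 2 delta and spatial side 2 K delta ^ alpha. Two ways of covering it
  by parabolic boxes give the two bounds:
  - one box of scale comparable to delta ^ (alpha / H), long enough in time
    because alpha <= H and delta <= 1, and costing, in dimension
    (H / alpha) s, a multiple of delta ^ s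
    ([parabolic_content_holder_box]);
  - a spatial grid of N ^ d boxes of scale 2 delta, N being of order
    delta ^ (alpha - H); the number of boxes is exactly paid for by the extra
    (H - alpha) d in the dimension ([parabolic_content_holder_grid]).
  Both rest on [parabolic_content_graph_eq0]: a local estimate of the content
  of the graph by a multiple of delta ^ s sums up over a Hausdorff cover, by
  countable subadditivity of the parabolic content
  ([parabolic_content_bigcup]).

  The equality for functions that are (H - e)-Hölder for all small e follows
  from the second bound, whose error term e d tends to 0. *)

(** * Parabolic Hausdorff content *)

Section parabolic_content_theory.
Variables (R : realType) (d : nat) (H beta : R).
Hypothesis beta_gt0 : (0 < beta)%R.
Implicit Types F G : set (R * 'rV[R]_d).

Lemma parabolic_content_ge0 F : 0 <= parabolic_content H beta F.
Proof.
apply: le_ereal_inf_tmp => _ [a [r [b [r0 _ ->]]]].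
by apply: nneseries_ge0 => k _ _; rewrite lee_fin powR_ge0.
Qed.

Lemma le_parabolic_content F G :
  F `<=` G -> parabolic_content H beta F <= parabolic_content H beta G.
Proof.
move=> FG; apply: ereal_inf_le_tmp => _ [a [r [b [r0 Gc ->]]]].
by exists a, r, b; split => //; apply: subset_trans Gc.
Qed.

(** Covers indexed by any countable type are admissible: re-indexing by nat
  through [pickle] leaves gaps, filled by boxes of scale 0, which cost nothing
  since beta > 0. *)
Lemma parabolic_content_le_esum (T : countType) (a r : T -> R)
    (b : T -> 'rV[R]_d) F : (forall t, 0 <= r t)%R ->
  F `<=` \bigcup_t parabolic_box H (a t) (r t) (b t) ->
  parabolic_content H beta F <= \esum_(t in [set: T]) (r t `^ beta)%:E.
Proof.
move=> r0 Fc.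
pose ext (V : Type) (v0 : V) (u : T -> V) n := oapp u v0 (pickle_inv n).
have extK V (v0 : V) (u : T -> V) t : ext V v0 u (pickle t) = u t.
  by rewrite /ext pickleK_inv.
apply: ge_ereal_inf; exists (\sum_(n <oo) (ext _ 0%R r n `^ beta)%:E).
  exists (ext _ 0%R a), (ext _ 0%R r), (ext _ 0%R b); split=> // [k|].
    by rewrite /ext; case: pickle_inv => [t|] /=; rewrite ?r0.
  by move=> p /Fc[t _ pt]; exists (pickle t) => //; rewrite !extK.
rewrite nneseries_esumT; last by move=> n; rewrite lee_fin powR_ge0.
have -> : \esum_(n in [set: nat]) (ext _ 0%R r n `^ beta)%:E
    = \esum_(n in range (@pickle T)) (ext _ 0%R r n `^ beta)%:E.
  rewrite [RHS]esum_mkcond; apply: eq_esum => n _.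
  case: ifPn => // /negP nT; rewrite /ext.
  case: pickle_inv (@pickle_invK T n) => [t /= tn|_ /=].
    by exfalso; apply: nT; rewrite inE; exists t.
  by rewrite powR0 // gt_eqF.
rewrite esum_image; last by move=> x y _ _ /(pcan_inj pickleK_inv).
by apply: le_esum => t _; rewrite extK.
Qed.

Lemma parabolic_content_le_fin (T : finType) (a : T -> R) (r : R)
    (b : T -> 'rV[R]_d) F : (0 <= r)%R ->
  F `<=` \bigcup_t parabolic_box H (a t) r (b t) ->
  parabolic_content H beta F <= (#|T|%:R * r `^ beta)%:E.
Proof.
move=> r0 Fc; apply: le_trans (parabolic_content_le_esum (fun=> r0) Fc) _.
rewrite esum_fset; first last.
- by move=> *; rewrite lee_fin powR_ge0.
- exact: finite_finset.
rewrite fsbig_finite/=; last exact: finite_finset.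
rewrite sumEFin big_const_seq iter_addr addr0 lee_fin mulr_natl.
rewrite ler_wpMn2l ?powR_ge0//.
rewrite count_predT cardE; apply: uniq_leq_size => [|t _].
  exact: finmap.fset_uniq.
by rewrite mem_enum.
Qed.

Lemma parabolic_content_set0 :
  parabolic_content H beta (set0 : set (R * 'rV[R]_d)) = 0.
Proof.
apply/eqP; rewrite eq_le parabolic_content_ge0 andbT.
apply: le_trans.
  apply: (@parabolic_content_le_fin void (fun=> 0%R) 0 (fun=> 0%R)).
- by [].
- by [].
- by rewrite card_void mul0r.
Qed.

(** Merge near-optimal covers of the F k, the k-th one losing at most
  e / 2 ^ (k + 1), into one cover indexed by pairs. *)
Lemma parabolic_content_bigcup (F : (set (R * 'rV[R]_d))^nat) :
  parabolic_content H beta (\bigcup_k F k) <=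
  \sum_(k <oo) parabolic_content H beta (F k).
Proof.
have [[k Fk]|] := pselect (exists k, parabolic_content H beta (F k) = +oo).
  rewrite (nneseries_pinfty _ _ Fk) ?leey// => *.
  exact: parabolic_content_ge0.
rewrite -forallNE => Foo; apply/lee_addgt0Pr => e e0.
apply: le_trans (epsilon_trick _ _ (ltW e0)); last first.
  by move=> n; exact: parabolic_content_ge0.
have /choice[c cP] k : exists c : R^nat * R^nat * ('rV[R]_d)^nat,
    [/\ forall n, (0 <= c.1.2 n)%R,
     F k `<=` \bigcup_n parabolic_box H (c.1.1 n) (c.1.2 n) (c.2 n) &
     \sum_(n <oo) (c.1.2 n `^ beta)%:E <=
       parabolic_content H beta (F k) + (e / (2 ^ k.+1)%:R)%:E].
  have fin : parabolic_content H beta (F k) \is a fin_num.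
    by rewrite ge0_fin_numE ?parabolic_content_ge0// ltey; apply/eqP/Foo.
  have : parabolic_content H beta (F k) <
      parabolic_content H beta (F k) + (e / (2 ^ k.+1)%:R)%:E.
    by rewrite lteDl// lte_fin divr_gt0// ltr0n expn_gt0.
  move/ereal_inf_lt => [_ [a [r [b [r0 Fc ->]]]] lt].
  by exists (a, r, b); split => //; exact: ltW.
apply: (@le_trans _ _ (\sum_(k <oo) \sum_(n <oo) ((c k).1.2 n `^ beta)%:E)).
  rewrite nneseries_esumT; last first.
    by move=> k; apply: nneseries_ge0 => n _ _; rewrite lee_fin powR_ge0.
  under eq_esum => k _.
    rewrite nneseries_esumT; last by move=> n; rewrite lee_fin powR_ge0.
    over.
  rewrite esum_esum; last by move=> *; rewrite lee_fin powR_ge0.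
  apply: le_trans.
    apply: (@parabolic_content_le_esum (nat * nat)%type
      (fun p => (c p.1).1.1 p.2) (fun p => (c p.1).1.2 p.2)
      (fun p => (c p.1).2 p.2)).
      by move=> p; case: (cP p.1).
    move=> p [k _ Fp]; have [_ /(_ _ Fp)[n _ np] _] := cP k.
    by exists (k, n).
  rewrite (_ : [set: nat] `*`` _ = setT)//.
  by apply/seteqP; split.
apply: lee_nneseries => [k _ _|k _]; last by have [] := cP k.
by apply: nneseries_ge0 => n _ _; rewrite lee_fin powR_ge0.
Qed.

End parabolic_content_theory.

(** * Diameters and Hausdorff measure *)

Section hausdorff_theory.
Variable R : realType.
Implicit Types (s e : R) (A U : set R).

Lemma le_diam U x y : U x -> U y -> (`|x - y|%R)%:E <= diam U.
Proof. by move=> Ux Uy; apply: ereal_sup_ubound; exists x => //; exists y. Qed.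

Lemma diam_le U e : (forall x y, U x -> U y -> `|x - y| <= e)%R ->
  diam U <= e%:E.
Proof.
by move=> Ue; apply: ge_ereal_sup => _ [x Ux [y Uy <-]]; rewrite lee_fin Ue.
Qed.

Lemma diam_fin U e : U !=set0 -> diam U <= e%:E ->
  exists2 r : R, (0 <= r <= e)%R & diam U = r%:E.
Proof.
move=> [t Ut] Ue.
have U0 : 0 <= diam U by rewrite (le_trans _ (le_diam Ut Ut))// lee_fin.
case: (diam U) Ue U0 => [r| |]//; rewrite !lee_fin => re r0.
by exists r; rewrite ?r0.
Qed.

Lemma diam_pow_ge0 s U : 0 <= diam_pow s U.
Proof. by rewrite /diam_pow; case: ifP => // _; exact: poweR_ge0. Qed.

Lemma diam_powE s U r : U !=set0 -> diam U = r%:E ->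
  diam_pow s U = (r `^ s)%:E.
Proof. by move=> /set0P/negbTE U0 Ur; rewrite /diam_pow U0 Ur. Qed.

Lemma diam_pow_le s U e : (0 <= s)%R -> (0 <= e)%R -> diam U <= e%:E ->
  diam_pow s U <= (e `^ s)%:E.
Proof.
move=> s0 e0 Ue; have [->|/set0P U0] := eqVneq U set0.
  by rewrite /diam_pow eqxx lee_fin powR_ge0.
have [r /andP[r0 re] Ur] := diam_fin U0 Ue.
by rewrite (diam_powE _ U0 Ur) lee_fin ge0_ler_powR ?nnegrE.
Qed.

Lemma hausdorff_premeasure_ge0 s e A : 0 <= hausdorff_premeasure s e A.
Proof.
apply: le_ereal_inf_tmp => _ [U _ <-].
by apply: nneseries_ge0 => k _ _; exact: diam_pow_ge0.
Qed.

Lemma hausdorff_measure_eq0P s A : hausdorff_measure s A = 0 <->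
  forall e eps : R, (0 < e)%R -> (0 < eps)%R -> exists U : (set R)^nat,
    [/\ A `<=` \bigcup_k U k, forall k, diam (U k) <= e%:E
      & \sum_(k <oo) diam_pow s (U k) <= eps%:E].
Proof.
split=> [A0 e eps e0 eps0|A0].
  have : hausdorff_premeasure s e A < eps%:E.
    apply: le_lt_trans (_ : 0 < eps%:E); last by rewrite lte_fin.
    by rewrite -A0; apply: ereal_sup_ubound; exists e.
  by move=> /ereal_inf_lt[_ [U [AU Ue] <-] /ltW]; exists U.
apply/eqP; rewrite eq_le; apply/andP; split.
  apply: ge_ereal_sup => _ [e /= e0 <-]; apply/lee_addgt0Pr => eps eps0.
  have [U [AU Ue Ueps]] := A0 _ _ e0 eps0.
  rewrite add0e; apply: ge_ereal_inf.
  by exists (\sum_(k <oo) diam_pow s (U k)) => //; exists U.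
apply: le_trans (hausdorff_premeasure_ge0 s 1 A) _.
by apply: ereal_sup_ubound; exists 1%R => /=.
Qed.

(** In dimension 0 each nonempty set of a cover costs 1. This isolates s = 0,
  for which H / alpha * s is not an admissible parabolic dimension. *)
Lemma hausdorff_measure0_eq0 A : hausdorff_measure 0 A = 0 -> A = set0.
Proof.
move=> /hausdorff_measure_eq0P /(_ 1 2^-1)%R[]//.
move=> U [AU _ Us]; apply/seteqP; split=> // t /AU[k _ Ukt].
have: 1 <= (2^-1)%:E :> \bar R.
  apply: le_trans Us; rewrite (@nneseriesD1 _ _ k)//; last first.
    by move=> *; exact: diam_pow_ge0.
  rewrite {1}/diam_pow ifF; last by apply/negP => /eqP Uk; rewrite Uk in Ukt.
  by rewrite poweRe0 leeDl// nneseries_ge0// => *; exact: diam_pow_ge0.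
by rewrite lee_fin leNgt invf_lt1// ltr1n.
Qed.

Lemma hausdorff_dim_ge0 A : 0 <= hausdorff_dim A.
Proof. by apply: le_ereal_inf_tmp => _ [s [s0 _] <-]; rewrite lee_fin. Qed.

End hausdorff_theory.

(** * From the graph to the base and back *)

Section graph.
Variables (R : realType) (d : nat) (H : R) (f : R -> 'rV[R]_d).
Implicit Types (s beta : R) (A : set R).

(** Projecting a cover of the graph on the time axis covers A. A cover of
  total cost below e ^ beta only has boxes of scale at most e, which controls
  the mesh. *)
Lemma hausdorff_measure_graph_eq0 beta A : (0 < beta)%R ->
  parabolic_content H beta (graph_on A f) = 0 -> hausdorff_measure beta A = 0.
Proof.
move=> beta0 cA; apply/hausdorff_measure_eq0P => e eps e0 eps0.
have : parabolic_content H beta (graph_on A f) < (Num.min (e `^ beta) eps)%:E.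
  by rewrite cA lte_fin lt_min powR_gt0.
move=> /ereal_inf_lt[_ [a [r [b [r0 Ac ->]]]] Slt].
have re k : (r k <= e)%R.
  rewrite leNgt; apply/negP => er.
  have : (r k `^ beta)%:E < (e `^ beta)%:E.
    apply: le_lt_trans (lt_le_trans Slt _); last by rewrite lee_fin ge_min lexx.
    rewrite (@nneseriesD1 _ _ k)//; last by move=> *; rewrite lee_fin powR_ge0.
    by rewrite leeDl// nneseries_ge0// => *; rewrite lee_fin powR_ge0.
  rewrite lte_fin ltNge ge0_ler_powR ?nnegrE//; exact: ltW.
pose U k := [set t : R | (a k <= t <= a k + r k)%R].
have Ur k : diam (U k) <= (r k)%:E.
  apply: diam_le => x y /andP[ax xr] /andP[ay yr].
  by rewrite ler_norml; apply/andP; split; lra.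
exists U; split.
- by move=> t At; have [|k _ [tk _]] := Ac (t, f t); [exists t|exists k].
- by move=> k; rewrite (le_trans (Ur k))// lee_fin.
- apply: le_trans (ltW (lt_le_trans Slt _)); last first.
    by rewrite lee_fin ge_min lexx orbT.
  apply: lee_nneseries => [k _ _|k _]; first exact: diam_pow_ge0.
  by apply: diam_pow_le => //; exact: ltW.
Qed.

(** A cheap cover of A by sets of diameter at most 1 turns the local estimate
  into a small bound on the whole content, by subadditivity. A real-valued
  diameter means that U is nonempty; the empty members of the cover contribute
  0 on both sides. *)
Lemma parabolic_content_graph_eq0 s beta C A : (0 < beta)%R -> (0 <= C)%R ->
  (forall (U : set R) (r : R), (0 <= r <= 1)%R -> diam U = r%:E ->
    parabolic_content H beta (graph_on (A `&` U) f) <= (C * r `^ s)%:E) ->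
  hausdorff_measure s A = 0 -> parabolic_content H beta (graph_on A f) = 0.
Proof.
move=> beta0 C0 loc A0; apply/eqP; rewrite eq_le parabolic_content_ge0 andbT.
apply/lee_addgt0Pr => eps eps0; rewrite add0e.
have C1 : (0 < C + 1)%R by rewrite ltr_wpDl.
(* C + 1 rather than C, which may be 0 *)
have /hausdorff_measure_eq0P/(_ 1%R (eps / (C + 1))%R) := A0.
move=> []// => [|U [AU U1 Us]]; first exact: divr_gt0.
apply: (@le_trans _ _ (C%:E * \sum_(k <oo) diam_pow s (U k))).
  rewrite -nneseriesZl; last by move=> *; exact: diam_pow_ge0.
  apply: le_trans.
    apply: (@le_parabolic_content _ _ _ _ _
      (\bigcup_k graph_on (A `&` U k) f)).
    by move=> _ [t At <-]; have [k _ Ukt] := AU _ At; exists k => //; exists t.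
  apply: le_trans (parabolic_content_bigcup _ beta0 _) _.
  apply: lee_nneseries => [k _ _|k _]; first exact: parabolic_content_ge0.
  have [Uk0|/set0P Uk0] := eqVneq (U k) set0.
    rewrite (_ : graph_on _ f = set0) ?parabolic_content_set0//.
      by rewrite mule_ge0 ?lee_fin// diam_pow_ge0.
    by rewrite Uk0 setI0 /graph_on image_set0.
  have [r r01 Ur] := diam_fin Uk0 (U1 k).
  by rewrite (diam_powE _ Uk0 Ur) -EFinM; exact: loc.
apply: le_trans (lee_wpmul2l _ Us) _; rewrite ?lee_fin//.
by rewrite mulrCA ger_pMr// ler_pdivrMr// mul1r lerDl.
Qed.

End graph.

(** * Graphs of Hölder functions *)

Lemma grid_cell (R : realType) (N : nat) (w x : R) : (0 < N)%N ->
  (0 <= x <= N%:R * w)%R -> exists j : 'I_N, (j%:R * w <= x <= j%:R * w + w)%R.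
Proof.
elim: N => // -[_ _|N IH _] /andP[x0 xN].
  by exists ord0; rewrite mul0r add0r x0 -[w]mul1r.
have [xN'|/ltW xN'] := leP x (N.+1%:R * w)%R.
  have [//||j jx] := IH; first by rewrite x0.
  by exists (widen_ord (leqnSn _) j).
by exists ord_max; rewrite xN' (le_trans xN)// -natr1 mulrDl mul1r.
Qed.

(** A slab whose duration is that of a box of scale r, and whose spatial side
  l may be larger, is cut in space into a grid of N ^ d such boxes, indexed by
  the functions from coordinates to cell numbers. *)
Lemma parabolic_content_slab (R : realType) (d N : nat) (H beta a r l : R)
    (b : 'rV[R]_d) (F : set (R * 'rV[R]_d)) :
  (0 < beta)%R -> (0 <= r)%R -> (0 < N)%N -> (l <= N%:R * r `^ H)%R ->
  (forall p, F p -> (a <= p.1 <= a + r)%R /\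
    forall i, (b ord0 i <= p.2 ord0 i <= b ord0 i + l)%R) ->
  parabolic_content H beta F <= (N%:R ^+ d * r `^ beta)%:E.
Proof.
move=> beta0 r0 N0 lN Fb.
have -> : (N%:R ^+ d = #|{ffun 'I_d -> 'I_N}|%:R :> R)%R.
  by rewrite card_ffun !card_ord natrX.
apply: (@parabolic_content_le_fin _ _ _ _ beta0 {ffun 'I_d -> 'I_N} (fun=> a) _
  (fun u => b + \row_i ((u i : nat)%:R * r `^ H))%R) => // p /Fb[pa pb].
have /choice[u up] i : exists j : 'I_N,
    (j%:R * r `^ H <= p.2 ord0 i - b ord0 i <= j%:R * r `^ H + r `^ H)%R.
  apply: grid_cell => //; have /andP[bp pl] := pb i.
  by rewrite subr_ge0 bp lerBlDl (le_trans pl)// lerD2l.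
exists [ffun i => u i] => //; split=> // i.
by rewrite !mxE ffunE; have /andP[] := up i; lra.
Qed.

Lemma coord_le_norm (R : realType) (d : nat) (v : 'rV[R]_d) i :
  (`|v ord0 i| <= `|v|)%R.
Proof.
rewrite [leRHS]mx_normrE.
exact: (le_bigmax _ (fun ij : 'I_1 * 'I_d => `|v ij.1 ij.2|%R) (ord0, i)).
Qed.

Section holder.
Variables (R : realType) (d : nat) (H alpha K : R) (f : R -> 'rV[R]_d).
Variable A : set R.
Hypotheses (K0 : (0 <= K)%R) (alphaH : (0 < alpha <= H)%R).
Hypothesis A01 : A `<=` `[0%R, 1%R].
Hypothesis fK : forall x y : R, x \in `[0%R, 1%R] -> y \in `[0%R, 1%R] ->
  (`|f x - f y| <= K * `|x - y| `^ alpha)%R.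

(** Centered at a point of A `&` U, the graph lies in a slab of duration
  2 delta and spatial side 2 K delta ^ alpha; the scale r and the grid size N
  are left free, their choice making the difference between the two upper
  bounds. *)
Lemma parabolic_content_holder beta delta r (N : nat) U :
  (0 < beta)%R -> diam U <= delta%:E -> (0 <= delta)%R -> (2 * delta <= r)%R ->
  (0 < N)%N -> (2 * K * delta `^ alpha <= N%:R * r `^ H)%R ->
  parabolic_content H beta (graph_on (A `&` U) f) <=
    (N%:R ^+ d * r `^ beta)%:E.
Proof.
move=> beta0 Ud d0 dr N0 KN; have r0 : (0 <= r)%R by lra.
have [[t [At Ut]]|AU0] := pselect (exists t, A t /\ U t); last first.
  apply: (@parabolic_content_slab _ _ _ _ _ 0 _ _ 0 _ beta0 r0 N0 KN).
  by move=> _ [t [At Ut] <-]; exfalso; apply: AU0; exists t.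
apply: (@parabolic_content_slab _ _ _ _ _ (t - delta) _ _
  (f t - const_mx (K * delta `^ alpha))%R _ beta0 r0 N0 KN).
move=> _ [x [Ax Ux] <-] /=.
have xt : (`|x - t| <= delta)%R.
  by rewrite -lee_fin (le_trans _ Ud)// le_diam.
split=> [|i]; first by move: xt; rewrite ler_norml => /andP[]; lra.
have : (`|f x ord0 i - f t ord0 i| <= K * delta `^ alpha)%R.
  have -> : (f x ord0 i - f t ord0 i = (f x - f t) ord0 i)%R by rewrite !mxE.
  apply: le_trans (coord_le_norm _ _) _.
  have [x01 t01] : x \in `[0%R, 1%R] /\ t \in `[0%R, 1%R].
    by split; exact: A01.
  apply: le_trans (fK x01 t01) _; apply: ler_wpM2l => //.
  by apply: ge0_ler_powR; rewrite ?nnegrE//; case/andP: alphaH => /ltW.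
by rewrite !mxE ler_norml => /andP[]; lra.
Qed.

(** A single box (N = 1) of scale r = c delta ^ (alpha / H), where c makes the
  box long enough (c >= 2) and wide enough (c ^ H >= 2 K). *)
Lemma parabolic_content_holder_box s : (0 < s)%R ->
  hausdorff_measure s A = 0 ->
  parabolic_content H (H / alpha * s) (graph_on A f) = 0.
Proof.
have /andP[a0 aH] := alphaH; have H0 : (0 < H)%R := lt_le_trans a0 aH.
move=> s0; have beta0 : (0 < H / alpha * s)%R by rewrite mulr_gt0// divr_gt0.
pose c := Num.max 2%R ((2 * K) `^ H^-1)%R.
have c2 : (2 <= c)%R by rewrite le_max lexx.
have c0 : (0 <= c)%R by rewrite le_max ler0n.
have cK : (2 * K <= c `^ H)%R.
  have K20 : (0 <= 2 * K)%R by rewrite mulr_ge0.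
  apply: (@le_trans _ _ (((2 * K) `^ H^-1) `^ H)%R).
    by rewrite -powRrM mulVf ?gt_eqF// powRr1.
  apply: ge0_ler_powR; rewrite ?nnegrE ?powR_ge0//; first exact: ltW.
  by rewrite le_max lexx orbT.
apply: (@parabolic_content_graph_eq0 R d H f s _
  (c `^ (H / alpha * s))%R) => //.
  exact: powR_ge0.
move=> U r /andP[r0 r1] Ur.
have -> : (c `^ (H / alpha * s) * r `^ s =
    1%:R ^+ d * (c * r `^ (alpha / H)) `^ (H / alpha * s))%R.
  rewrite expr1n mul1r powRM ?powR_ge0// -powRrM; congr (_ * _ `^ _)%R.
  by field; rewrite !gt_eqF.
apply: (@parabolic_content_holder _ r) => //; first by rewrite Ur.
  apply: ler_pM => //.
  have [->|rn0] := eqVneq r 0%R; first exact: powR_ge0.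
  rewrite -[leLHS]powRr1//; apply: ger_powR; first by rewrite lt0r rn0 r0.
  by rewrite ler_pdivrMr// mul1r.
rewrite mul1r powRM ?powR_ge0// -powRrM divfK ?gt_eqF//.
by rewrite ler_wpM2r// powR_ge0.
Qed.

(** Boxes of scale 2 delta, in number at most
  ((2 K + 1) delta ^ (alpha - H)) ^ d. *)
Lemma parabolic_content_holder_grid s : (0 < s)%R ->
  hausdorff_measure s A = 0 ->
  parabolic_content H (s + (H - alpha) * d%:R) (graph_on A f) = 0.
Proof.
have /andP[a0 aH] := alphaH; have H0 : (0 < H)%R := lt_le_trans a0 aH.
move=> s0; set beta := (s + _)%R.
have K20 : (0 <= 2 * K)%R by rewrite mulr_ge0.
have K21 : (0 <= 2 * K + 1)%R by rewrite addr_ge0.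
have beta0 : (0 < beta)%R by rewrite ltr_pwDl// mulr_ge0// subr_ge0.
apply: (@parabolic_content_graph_eq0 R d H f s _
  ((2 * K + 1) ^+ d * 2 `^ beta)%R) => //.
  by rewrite mulr_ge0 ?powR_ge0// exprn_ge0.
move=> U r /andP[r0 r1] Ur.
(* For r = 0 the grid size N below would carry no information, as
   0 `^ (alpha - H) is 0 for alpha < H; one box of scale 0 suffices. *)
have [r0'|rn0] := eqVneq r 0%R.
  rewrite r0' (powR0 (lt0r_neq0 s0)) mulr0.
  apply: (@le_trans _ _ (1%:R ^+ d * 0 `^ beta)%:E); last first.
    by rewrite powR0 ?mulr0// gt_eqF.
  apply: (@parabolic_content_holder _ r) => //; rewrite ?Ur ?r0'//.
  by rewrite !powR0 ?gt_eqF// !mulr0.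
have rgt0 : (0 < r)%R by rewrite lt0r rn0.
set N := (Num.truncn (2 * K * r `^ (alpha - H))).+1.
(* The + 1 due to rounding is absorbed as r `^ (alpha - H) >= 1. *)
have NK : (N%:R <= (2 * K + 1) * r `^ (alpha - H))%R.
  rewrite [leRHS](mulrDl (2 * K)%R) mul1r /N -natr1; apply: lerD.
    by rewrite truncn_le mulr_ge0 ?powR_ge0//; lra.
  rewrite -(powRr0 r); apply: ger_powR; first by rewrite rgt0.
  by rewrite subr_le0.
apply: (@le_trans _ _ (N%:R ^+ d * (2 * r) `^ beta)%:E).
  apply: (@parabolic_content_holder _ r) => //; first by rewrite Ur.
  apply: (@le_trans _ _ (N%:R * r `^ H)%R).
    have {1}-> : (alpha = (alpha - H) + H)%R by rewrite subrK.
    rewrite powRD ?rn0 ?implybT// mulrA ler_wpM2r ?powR_ge0//.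
    exact/ltW/truncnS_gt.
  by rewrite ler_wpM2l// ge0_ler_powR ?nnegrE//; lra.
rewrite lee_fin powRM// mulrCA [leRHS]mulrAC mulrC ler_wpM2r ?powR_ge0//.
apply: (@le_trans _ _ (((2 * K + 1) * r `^ (alpha - H)) ^+ d * r `^ beta)%R).
  rewrite ler_wpM2r ?powR_ge0//; apply: lerXn2r; rewrite ?nnegrE//.
  by rewrite mulr_ge0 ?powR_ge0.
rewrite exprMn -mulrA ler_wpM2l ?exprn_ge0//.
rewrite -powR_mulrn ?powR_ge0// -powRrM -powRD ?rn0 ?implybT//.
by rewrite /beta addrCA -mulrDl addrA subrK subrr mul0r addr0.
Qed.

End holder.

(** * Comparison of dimensions *)

Lemma hausdorff_dim_le_parabolic (R : realType) (d : nat) (H : R)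
    (f : R -> 'rV[R]_d) (A : set R) :
  hausdorff_dim A <= parabolic_dim H (graph_on A f).
Proof.
apply: le_ereal_inf_tmp => _ [beta [beta0 cA] <-].
apply: ereal_inf_lbound; exists beta => //; split; first exact: ltW.
exact: hausdorff_measure_graph_eq0 cA.
Qed.

Lemma parabolic_dim_holder (R : realType) (d : nat) (H alpha : R)
    (f : R -> 'rV[R]_d) (A : set R) : A `<=` `[0%R, 1%R] ->
  (0 < alpha <= H)%R -> holder01 alpha f ->
  parabolic_dim H (graph_on A f) <=
    mine ((H / alpha)%:E * hausdorff_dim A)
         (hausdorff_dim A + ((H - alpha) * d%:R)%:E).
Proof.
move=> A01 alphaH [K K0 fK]; have /andP[a0 aH] := alphaH.
have Ha : (0 < H / alpha)%R by rewrite divr_gt0// (lt_le_trans a0).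
have Had : (0 <= (H - alpha) * d%:R)%R by rewrite mulr_ge0// subr_ge0.
have [->|A0] := eqVneq A set0.
  apply: (@le_trans _ _ 0); last first.
    by rewrite le_min mule_ge0 ?adde_ge0 ?hausdorff_dim_ge0 ?lee_fin// ltW.
  apply/lee_addgt0Pr => e e0; rewrite add0e.
  apply: ereal_inf_lbound; exists e => //; split => //.
  by rewrite /graph_on image_set0 parabolic_content_set0.
have spos s : (0 <= s)%R -> hausdorff_measure s A = 0 -> (0 < s)%R.
  rewrite le_eqVlt => /predU1P[<-|//] /hausdorff_measure0_eq0 A0'.
  by rewrite A0' eqxx in A0.
rewrite le_min; apply/andP; split.
  rewrite -lee_pdivrMl//; apply: le_ereal_inf_tmp => _ [s [s0 sA] <-].
  have {}s0 := spos _ s0 sA.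
  rewrite lee_pdivrMl// -EFinM; apply: ereal_inf_lbound.
  exists (H / alpha * s)%R => //; split; first exact: mulr_gt0.
  exact: parabolic_content_holder_box fK _ s0 sA.
rewrite -leeBlDr//; apply: le_ereal_inf_tmp => _ [s [s0 sA] <-].
have {}s0 := spos _ s0 sA.
rewrite leeBlDr// -EFinD; apply: ereal_inf_lbound.
exists (s + (H - alpha) * d%:R)%R => //; split; first by rewrite ltr_pwDl.
exact: parabolic_content_holder_grid fK _ s0 sA.
Qed.

Theorem proposition2p7 (R : realType) (d : nat) (H : R)
  (f : R -> 'rV[R]_d) (A : set R)
  (hd : (1 <= d)%N) (hH : (0 < H < 1)%R)
  (mf : measurable_fun (`[0%R, 1%R] : set R) (f : R -> borel_rV R d))
  (mA : measurable A) (A01 : A `<=` `[0%R, 1%R]) :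
  [/\ hausdorff_dim A <= parabolic_dim H (graph_on A f),
      forall alpha : R, (0 < alpha <= H)%R -> holder01 alpha f ->
        parabolic_dim H (graph_on A f) <=
          mine ((H / alpha)%:E * hausdorff_dim A)
               (hausdorff_dim A + ((H - alpha) * d%:R)%:E)
    & (\forall e \near (0%R : R)^'+, holder01 (H - e)%R f) ->
      hausdorff_dim A = parabolic_dim H (graph_on A f)].
Proof.
split=> [|alpha alphaH fa|fH]; first exact: hausdorff_dim_le_parabolic.
  exact: parabolic_dim_holder.
have /andP[H0 _] := hH; have d0 : (0 < d%:R :> R)%R by rewrite ltr0n.
apply/eqP; rewrite eq_le hausdorff_dim_le_parabolic/=.
apply/lee_addgt0Pr => eta eta0.
have etad : (0 < eta / d%:R)%R by rewrite divr_gt0.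
near (0%R : R)^'+ => e.
have fe : holder01 (H - e)%R f by near: e.
have e0 : (0 < e)%R by near: e; exact: nbhs_right_gt.
have eH : (e < H)%R by near: e; exact: nbhs_right_lt.
have ed : (e <= eta / d%:R)%R.
  by apply/ltW; near: e; exact: nbhs_right_lt.
have alphaH : (0 < H - e <= H)%R by rewrite subr_gt0 eH gerBl ltW.
have := parabolic_dim_holder A01 alphaH fe.
rewrite le_min => /andP[_ /le_trans]; apply.
by rewrite leeD2l// lee_fin subKr -ler_pdivlMr.
Unshelve. all: by end_near.
Qed.
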